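(* Let $\rho$ be any separable two-qubit state, and let $\mathcal R^{(2)},\mathcal R^{(4)}$ be its second and fourth moments of random correlations. Then $$F(\mathcal R^{(2)},\mathcal R^{(4)})\ \ge\ 0,\qquad F(\mathcal R^{(2)},\mathcal R^{(4)}):=\mathcal R^{(4)}-f_{\mathrm{LB,sep}}(\mathcal R^{(2)}),$$ where $$f_{\mathrm{LB,sep}}(r)=\begin{cases}\dfrac{5\cdot 3^4}{15^2}\,r^2, & 0\le r\le \frac1{27},\\[2mm] \dfrac{3^2}{15^2}\left(2r+54r^2-\dfrac{4\sqrt2}{3^4}\,(27r-1)^{3/2}-\dfrac{7}{3^4}\right), & \frac1{27}\le r\le \frac1{18},\\[2mm] \dfrac{3^2}{15^2}\left(54r^2+6r-\dfrac13\right), & \frac1{18}\le r\le \frac13.\end{cases}$$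
   Context: For a unit vector $\boldsymbol u\in S^2\subset\mathbb R^3$ let $\sigma_{\boldsymbol u}=u_x\sigma_x+u_y\sigma_y+u_z\sigma_z$ with the Pauli matrices $\sigma_x,\sigma_y,\sigma_z$. For a two-qubit state (density matrix on $\mathbb C^2\otimes\mathbb C^2$) $\rho$, the correlation function is $E(\boldsymbol u_1,\boldsymbol u_2)=\mathrm{tr}[\rho\,(\sigma_{\boldsymbol u_1}\otimes\sigma_{\boldsymbol u_2})]$, and for a positive integer $t$ the $t$-th moment of random correlations is $$\mathcal R^{(t)}=\frac1{(4\pi)^2}\int_{S^2}d\boldsymbol u_1\int_{S^2}d\boldsymbol u_2\,E(\boldsymbol u_1,\boldsymbol u_2)^t,$$ where $d\boldsymbol u=\sin\theta\,d\theta\,d\phi$ is the unnormalized uniform (surface) measure on $S^2$. A state is separable if it is a convex combination of product states $\rho_A\otimes\rho_B$. One has $0\le\mathcal R^{(2)}\le 1/3$ for every two-qubit state. *)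

(* Defs.v *)
From HB Require Import structures.
From mathcomp Require Import all_boot all_order all_algebra.
From mathcomp Require Import all_classical all_reals all_analysis.
From mathcomp Require Import sesquilinear spectral.
From mathcomp.real_closed Require Import complex mxtens.

Set Implicit Arguments.
Unset Strict Implicit.
Unset Printing Implicit Defensive.

Import Order.TTheory GRing.Theory Num.Theory.
Import numFieldNormedType.Exports.

Local Open Scope classical_set_scope.
Local Open Scope ring_scope.
Local Open Scope complex_scope.
Local Open Scope sesquilinear_scope.

Section States.
Variable R : realType.

(* In the order of [R[i]], [0 <= z] says that [z] is real and nonnegative. *)
Definition is_psd n (A : 'M[R[i]]_n) : Prop :=
  A \is hermsymmx /\
  forall v : 'cV[R[i]]_n, 0 <= (v^t* *m A *m v) ord0 ord0.

Definition is_density n (A : 'M[R[i]]_n) : Prop := is_psd A /\ \tr A = 1.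

(* The Kronecker product [A *t B] acts on C^2 (x) C^2, identified with
   C^(2 * 2). *)
Definition is_separable (rho : 'M[R[i]]_(2 * 2)) : Prop :=
  exists (n : nat) (p : 'I_n -> R) (rhoA rhoB : 'I_n -> 'M[R[i]]_2),
    [/\ forall k, 0 <= p k,
        \sum_(k < n) p k = 1,
        forall k, is_density (rhoA k),
        forall k, is_density (rhoB k)
      & rho = \sum_(k < n) (p k)%:C *: (rhoA k *t rhoB k)].

End States.

Section Moments.
Variable R : realType.

Definition mx2 (a b c d : R[i]) : 'M[R[i]]_2 :=
  \matrix_(i, j) (if i == 0 then (if j == 0 then a else b)
                  else (if j == 0 then c else d)).

Definition sigma_x : 'M[R[i]]_2 := mx2 0 1 1 0.
Definition sigma_y : 'M[R[i]]_2 := mx2 0 (0 -i* 1) (0 +i* 1) 0.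
Definition sigma_z : 'M[R[i]]_2 := mx2 1 0 0 (-1).

Definition sigma (u : 'rV[R]_3) : 'M[R[i]]_2 :=
  (u 0 0)%:C *: sigma_x + (u 0 1)%:C *: sigma_y + (u 0 2%:R)%:C *: sigma_z.

(* The trace is real when [rho] is Hermitian, so taking the real part only
   changes its type. *)
Definition correlation (rho : 'M[R[i]]_(2 * 2)) (u1 u2 : 'rV[R]_3) : R :=
  complex.Re (\tr (rho *m (sigma u1 *t sigma u2))).

Definition sphere_point (theta phi : R) : 'rV[R]_3 :=
  \row_(i < 3) [:: sin theta * cos phi; sin theta * sin phi; cos theta]`_i.

(* Integral over S^2 against the unnormalized surface measure (total mass
   4 pi), written in spherical coordinates. *)
Definition sphere_integral (f : 'rV[R]_3 -> R) : R :=
  \int[lebesgue_measure]_(theta in `[0, pi])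
    \int[lebesgue_measure]_(phi in `[0, 2 * pi])
      (f (sphere_point theta phi) * sin theta).

Definition moment (rho : 'M[R[i]]_(2 * 2)) (t : nat) : R :=
  ((4 * pi) ^+ 2)^-1 *
  sphere_integral (fun u1 =>
    sphere_integral (fun u2 => correlation rho u1 u2 ^+ t)).

(* Only meant for [0 <= r <= 1/3]; adjacent branches agree at [1/27] and
   [1/18]. *)
Definition f_LB_sep (r : R) : R :=
  if r <= 1 / 27 then 5 * 3 ^+ 4 / 15 ^+ 2 * r ^+ 2
  else if r <= 1 / 18 then
    3 ^+ 2 / 15 ^+ 2 *
      (2 * r + 54 * r ^+ 2
       - 4 * Num.sqrt 2 / 3 ^+ 4 * (27 * r - 1) `^ (3 / 2)
       - 7 / 3 ^+ 4)
  else 3 ^+ 2 / 15 ^+ 2 * (54 * r ^+ 2 + 6 * r - 1 / 3).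

Definition F_sep (r2 r4 : R) : R := r4 - f_LB_sep r2.

End Moments.

(* Main.v *)
Require Import Defs.
From mathcomp Require Import all_boot all_order all_algebra.
From mathcomp Require Import all_classical all_reals all_analysis.
From mathcomp Require Import sesquilinear spectral.
From mathcomp.real_closed Require Import complex mxtens.
From mathcomp Require Import ring lra.

(* For a separable state the correlation function is [E(u, v) = u T v^T], where
   [T] is a convex combination of matrices [a^T b] of Bloch vectors of norm at
   most 1. Integrating over the spheres gives
     R2 = tr(T T^T) / 9,   R4 = (tr(T T^T)^2 + 2 tr((T T^T)^2)) / 75,
   so only the singular values [x, y, z] of [T] matter, and separability forces
   the trace norm [x + y + z] to be at most 1. It remains to minimize
   [x^4 + y^4 + z^4] for fixed [q = x^2 + y^2 + z^2]: the optimum is [x = y = z]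
   for [q <= 1/3], of the form [(c, c, d)] with [c >= d] for
   [1/3 <= q <= 1/2], and of the form [(c, d, 0)] beyond; these are the three
   branches of [f_LB_sep]. *)

Set Implicit Arguments.
Unset Strict Implicit.
Unset Printing Implicit Defensive.

Import Order.TTheory GRing.Theory Num.Theory.
Import numFieldNormedType.Exports.
Local Open Scope classical_set_scope.
Local Open Scope ring_scope.
Local Open Scope complex_scope.
Local Open Scope sesquilinear_scope.

(** * Integrals of polynomials over the sphere *)

Section TrigIntegrals.
Variable R : realType.
Implicit Types (F G f g : R -> R) (x a b k : R).

(** Continuity of [f] is bundled in because the fundamental theorem of calculus needs it. *)
Definition antiderivative F f :=
  (forall x, is_derive x (1 : R) F (f x)) /\ continuous f.

Lemma antiderivativeD F G f g : antiderivative F f -> antiderivative G g ->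
  antiderivative (fun x => F x + G x) (fun x => f x + g x).
Proof.
move=> [dF cf] [dG cg]; split => x; first exact: is_deriveD.
by apply: continuousD; [exact: cf|exact: cg].
Qed.

Lemma antiderivativeZ k F f : antiderivative F f ->
  antiderivative (fun x => k * F x) (fun x => k * f x).
Proof.
move=> [dF cf]; split => x; first exact: is_deriveZ.
by apply: continuousM; [exact: cst_continuous|exact: cf].
Qed.

Lemma Rintegral_antiderivative F f a b : a < b -> antiderivative F f ->
  \int[lebesgue_measure]_(x in `[a, b]) f x = F b - F a.
Proof.
move=> ab [dF cf]; have cF : continuous F.
  move=> x; apply/differentiable_continuous/derivable1_diffP.
  exact: (@ex_derive _ _ _ _ _ _ _ (dF x)).
rewrite /Rintegral (@continuous_FTC2 _ _ F)//.
- exact/continuous_subspaceT.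
- split; first by move=> x _; apply: ex_derive; exact: dF.
  + exact/cvg_at_right_filter/cF.
  + exact/cvg_at_left_filter/cF.
- by move=> x _; rewrite derive1E; exact: derive_val.
Qed.

Lemma continuous_cosX_sinX (i j : nat) :
  continuous (fun x : R => cos x ^+ i * sin x ^+ j).
Proof.
move=> x.
have cc : {for x, continuous (fun y : R => cos y ^+ i)}.
  by apply: (@continuous_comp _ _ _ cos (fun y => y ^+ i));
    [exact: continuous_cos|exact: exprn_continuous].
have cs : {for x, continuous (fun y : R => sin y ^+ j)}.
  by apply: (@continuous_comp _ _ _ sin (fun y => y ^+ j));
    [exact: continuous_sin|exact: exprn_continuous].
exact: (continuousM cc cs).
Qed.

(* Meaningful only for the exponents listed in [trig_exponents] below. *)
Definition trig_antider (i j : nat) (x : R) : R :=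
  let c := cos x in let s := sin x in
  match i, j with
  | 4, 0 => 3/8 * x + (3/8 * (c * s) + 1/4 * (c ^+ 3 * s))
  | 3, 1 => -1/4 * c ^+ 4
  | 2, 2 => 1/8 * x + (-1/8 * (c ^+ 3 * s) + 1/8 * (c * s ^+ 3))
  | 1, 3 => 1/4 * s ^+ 4
  | 0, 4 => 3/8 * x + (-3/8 * (c * s) + -1/4 * (s ^+ 3 * c))
  | 3, 0 => s + -1/3 * s ^+ 3
  | 2, 1 => -1/3 * c ^+ 3
  | 1, 2 => 1/3 * s ^+ 3
  | 0, 3 => -1 * c + 1/3 * c ^+ 3
  | 2, 0 => 1/2 * x + 1/2 * (c * s)
  | 1, 1 => 1/2 * s ^+ 2
  | 0, 2 => 1/2 * x + -1/2 * (c * s)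
  | 1, 0 => s
  | 0, 1 => -1 * c
  | 0, 0 => x
  | 0, 5 => -1 * c + (2/3 * c ^+ 3 + -1/5 * c ^+ 5)
  | 2, 3 => -1/3 * c ^+ 3 + 1/5 * c ^+ 5
  | 4, 1 => -1/5 * c ^+ 5
  | _, _ => 0
  end.

(** All pairs of total degree at most 4, enough for the azimuthal integrals, then the three pairs of
    degree 5 that occur in the polar integral of a quartic, where the surface factor [sin theta]
    adds one degree. *)
Definition trig_exponents : seq (nat * nat) :=
  [:: (4, 0); (3, 1); (2, 2); (1, 3); (0, 4); (3, 0); (2, 1); (1, 2); (0, 3);
      (2, 0); (1, 1); (0, 2); (1, 0); (0, 1); (0, 0);
      (0, 5); (2, 3); (4, 1)]%N.

Lemma trig_antiderP (i j : nat) :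
  (i, j) \in trig_exponents ->
  antiderivative (trig_antider i j) (fun x => cos x ^+ i * sin x ^+ j).
Proof.
rewrite /trig_exponents => ij; split; last exact: continuous_cosX_sinX.
move=> x; have cs := cos2Dsin2 x.
(* Higher powers of the sine are reduced modulo the Pythagorean identity, so that each derivative
   check becomes polynomial algebra. *)
have s2 : sin x ^+ 2 = 1 - cos x ^+ 2 by rewrite -cs addrC addKr.
have s3 : sin x ^+ 3 = sin x * (1 - cos x ^+ 2) by rewrite -s2 exprS.
have s4 : sin x ^+ 4 = (1 - cos x ^+ 2) ^+ 2 by rewrite -s2 -exprM.
have s5 : sin x ^+ 5 = sin x * (1 - cos x ^+ 2) ^+ 2 by rewrite -s4 exprS.
move: ij; rewrite !inE.
do !(case/orP); move/eqP => [-> ->]; rewrite /trig_antider /=;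
  apply: is_derive_eq; rewrite /GRing.scale /=;
  first [by field | rewrite ?s5 ?s4 ?s3 ?s2; first [by field | by nra]].
Qed.

(** Lists of coefficients and exponents let the admissibility of every monomial be decided by
    computation. *)
Definition trig_poly (s : seq (R * (nat * nat))) (x : R) : R :=
  \sum_(m <- s) m.1 * (cos x ^+ m.2.1 * sin x ^+ m.2.2).

Definition trig_poly_antider (s : seq (R * (nat * nat))) (x : R) : R :=
  \sum_(m <- s) m.1 * trig_antider m.2.1 m.2.2 x.

Lemma Rintegral_trig_poly (s : seq (R * (nat * nat))) a b : a < b ->
  all (fun m => m.2 \in trig_exponents) s ->
  \int[lebesgue_measure]_(x in `[a, b]) trig_poly s x
  = trig_poly_antider s b - trig_poly_antider s a.
Proof.
move=> ab hs; apply: Rintegral_antiderivative => //.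
elim: s hs => [_|[k [i j]] s ih /= /andP[ij /ih{}ih]].
  split => x; last first.
    rewrite /trig_poly; under eq_fun do rewrite big_nil.
    exact: cst_continuous.
  rewrite /trig_poly_antider /trig_poly big_nil; under eq_fun do rewrite big_nil.
  exact: is_derive_cst.
rewrite /trig_poly_antider /trig_poly.
under eq_fun do rewrite big_cons.
under [in X in antiderivative _ X]eq_fun do rewrite big_cons.
by apply: antiderivativeD => //; apply: antiderivativeZ; exact: trig_antiderP.
Qed.

(** Mean of [cos x ^+ i * sin x ^+ j] over a full period, correct only for exponents in
    [trig_exponents]. *)
Definition trig_mean (i j : nat) : R :=
  match i, j with
  | 4, 0 | 0, 4 => 3 / 8
  | 2, 2 => 1 / 8
  | 2, 0 | 0, 2 => 1 / 2
  | 0, 0 => 1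
  | _, _ => 0
  end.

Lemma integral_trig_poly_period (s : seq (R * (nat * nat))) :
  all (fun m => m.2 \in trig_exponents) s ->
  \int[lebesgue_measure]_(x in `[0, 2 * pi]) trig_poly s x
  = 2 * pi * \sum_(m <- s) m.1 * trig_mean m.2.1 m.2.2.
Proof.
move=> hs.
have c2 : cos (2 * pi) = 1 :> R by rewrite mulr_natl cos2pi.
have s2 : sin (2 * pi) = 0 :> R by rewrite mulr_natl sin2pi.
rewrite Rintegral_trig_poly// ?mulr_gt0 ?pi_gt0//.
rewrite /trig_poly_antider -sumrB mulr_sumr.
apply: eq_big_seq => -[k [i j]] ms /=.
have := allP hs _ ms; rewrite /= !inE -mulrBr mulrCA => ij.
congr (_ * _).
move: ij; do !(case/orP); move/eqP => [-> ->];
  by rewrite /trig_antider /trig_mean ?c2 ?s2 ?cos0 ?sin0; field.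
Qed.

Lemma integral_trig_poly_half_period (s : seq (R * (nat * nat))) :
  all (fun m => m.2 \in trig_exponents) s ->
  \int[lebesgue_measure]_(x in `[0, pi]) trig_poly s x
  = trig_poly_antider s pi - trig_poly_antider s 0.
Proof. by move=> hs; rewrite Rintegral_trig_poly// ?pi_gt0. Qed.

Lemma sphere_integral_quadratic (c200 c110 c101 c020 c011 c002 : R)
    (f : 'rV[R]_3 -> R) :
  (forall u, f u =
    c200 * (u 0 0 ^+ 2) + c110 * (u 0 0 * u 0 1) + c101 * (u 0 0 * u 0 2%:R)
    + c020 * (u 0 1 ^+ 2) + c011 * (u 0 1 * u 0 2%:R) + c002 * (u 0 2%:R ^+ 2)) ->
  sphere_integral f = 4 * pi / 3 * (c200 + c020 + c002).
Proof.
move=> fE; rewrite /sphere_integral.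
(* The list is what remains after integrating over [phi]: mixed monomials have mean 0, and both
   squares have mean 1/2. *)
transitivity (\int[lebesgue_measure]_(theta in `[0, pi]) trig_poly
    [:: (pi * (c200 + c020), (0, 3)%N); (2 * pi * c002, (2, 1)%N)] theta).
  apply: eq_Rintegral => theta _.
  transitivity (\int[lebesgue_measure]_(phi in `[0, 2 * pi]) trig_poly
    [::
      (c200 * (sin theta ^+ 3), (2, 0)%N);
      (c110 * (sin theta ^+ 3), (1, 1)%N);
      (c101 * (sin theta ^+ 2 * cos theta), (1, 0)%N);
      (c020 * (sin theta ^+ 3), (0, 2)%N);
      (c011 * (sin theta ^+ 2 * cos theta), (0, 1)%N);
      (c002 * (sin theta ^+ 1 * cos theta ^+ 2), (0, 0)%N)] phi).
    apply: eq_Rintegral => phi _.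
    by rewrite fE /sphere_point !mxE /= /trig_poly !big_cons big_nil /=; ring.
  rewrite integral_trig_poly_period// /trig_mean /trig_poly !big_cons !big_nil /=.
  by field.
rewrite integral_trig_poly_half_period// /trig_poly_antider !big_cons !big_nil.
by rewrite /trig_antider /= ?cospi ?cos0 ?sinpi ?sin0; field.
Qed.

(** On the sphere a fourth power of a coordinate has mean 3/15, a product of two distinct squares
    has mean 1/15, and monomials with an odd exponent have mean 0. *)
Lemma sphere_integral_quartic
    (c400 c310 c301 c220 c211 c202 c130 c121 c112 c103 c040 c031 c022 c013
     c004 : R) (f : 'rV[R]_3 -> R) :
  (forall u, f u =
    c400 * (u 0 0 ^+ 4) + c310 * (u 0 0 ^+ 3 * u 0 1)
    + c301 * (u 0 0 ^+ 3 * u 0 2%:R) + c220 * (u 0 0 ^+ 2 * u 0 1 ^+ 2)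
    + c211 * (u 0 0 ^+ 2 * u 0 1 * u 0 2%:R)
    + c202 * (u 0 0 ^+ 2 * u 0 2%:R ^+ 2) + c130 * (u 0 0 * u 0 1 ^+ 3)
    + c121 * (u 0 0 * u 0 1 ^+ 2 * u 0 2%:R)
    + c112 * (u 0 0 * u 0 1 * u 0 2%:R ^+ 2) + c103 * (u 0 0 * u 0 2%:R ^+ 3)
    + c040 * (u 0 1 ^+ 4) + c031 * (u 0 1 ^+ 3 * u 0 2%:R)
    + c022 * (u 0 1 ^+ 2 * u 0 2%:R ^+ 2) + c013 * (u 0 1 * u 0 2%:R ^+ 3)
    + c004 * (u 0 2%:R ^+ 4)) ->
  sphere_integral f = 4 * pi / 15 *
    (3 * (c400 + c040 + c004) + c220 + c202 + c022).
Proof.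
move=> fE; rewrite /sphere_integral.
transitivity (\int[lebesgue_measure]_(theta in `[0, pi]) trig_poly
    [:: (pi / 4 * (3 * (c400 + c040) + c220), (0, 5)%N);
        (pi * (c202 + c022), (2, 3)%N); (2 * pi * c004, (4, 1)%N)] theta).
  apply: eq_Rintegral => theta _.
  transitivity (\int[lebesgue_measure]_(phi in `[0, 2 * pi]) trig_poly
    [::
      (c400 * (sin theta ^+ 5), (4, 0)%N);
      (c310 * (sin theta ^+ 5), (3, 1)%N);
      (c301 * (sin theta ^+ 4 * cos theta), (3, 0)%N);
      (c220 * (sin theta ^+ 5), (2, 2)%N);
      (c211 * (sin theta ^+ 4 * cos theta), (2, 1)%N);
      (c202 * (sin theta ^+ 3 * cos theta ^+ 2), (2, 0)%N);
      (c130 * (sin theta ^+ 5), (1, 3)%N);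
      (c121 * (sin theta ^+ 4 * cos theta), (1, 2)%N);
      (c112 * (sin theta ^+ 3 * cos theta ^+ 2), (1, 1)%N);
      (c103 * (sin theta ^+ 2 * cos theta ^+ 3), (1, 0)%N);
      (c040 * (sin theta ^+ 5), (0, 4)%N);
      (c031 * (sin theta ^+ 4 * cos theta), (0, 3)%N);
      (c022 * (sin theta ^+ 3 * cos theta ^+ 2), (0, 2)%N);
      (c013 * (sin theta ^+ 2 * cos theta ^+ 3), (0, 1)%N);
      (c004 * (sin theta ^+ 1 * cos theta ^+ 4), (0, 0)%N)] phi).
    apply: eq_Rintegral => phi _.
    by rewrite fE /sphere_point !mxE /= /trig_poly !big_cons big_nil /=; ring.
  rewrite integral_trig_poly_period// /trig_mean /trig_poly !big_cons !big_nil /=.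
  by field.
rewrite integral_trig_poly_half_period// /trig_poly_antider !big_cons !big_nil.
by rewrite /trig_antider /= ?cospi ?cos0 ?sinpi ?sin0; field.
Qed.

End TrigIntegrals.

(** * Moments *)

Section Moments.
Variable R : realType.

Lemma sum_ord3 (V : nmodType) (F : 'I_3 -> V) :
  \sum_i F i = F 0 + F 1 + F 2%:R.
Proof.
rewrite !big_ord_recl big_ord0 addr0 addrA.
by congr (F _ + F _ + F _); apply/val_inj.
Qed.

Lemma quad_formE (N : 'M[R]_3) (u : 'rV[R]_3) : N^T = N ->
  (u *m N *m u^T) 0 0 =
  N 0 0 * u 0 0 ^+ 2 + N 1 1 * u 0 1 ^+ 2 + N 2%:R 2%:R * u 0 2%:R ^+ 2
  + 2 * (N 0 1 * (u 0 0 * u 0 1) + N 0 2%:R * (u 0 0 * u 0 2%:R)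
         + N 1 2%:R * (u 0 1 * u 0 2%:R)).
Proof.
move=> /matrixP NT; rewrite !mxE sum_ord3 !mxE !sum_ord3.
have := NT 0 1; have := NT 0 2%:R; have := NT 1 2%:R; rewrite !mxE => -> -> ->.
by ring.
Qed.

Lemma sphere_integral_quad_form (N : 'M[R]_3) : N^T = N ->
  sphere_integral (fun u => (u *m N *m u^T) 0 0) = 4 * pi / 3 * \tr N.
Proof.
move=> NT; rewrite (@sphere_integral_quadratic R (N 0 0) (2 * N 0 1)
  (2 * N 0 2%:R) (N 1 1) (2 * N 1 2%:R) (N 2%:R 2%:R)).
  by rewrite /mxtrace sum_ord3.
by move=> u; rewrite quad_formE//; ring.
Qed.

Lemma sphere_integral_quad_form_sqr (N : 'M[R]_3) : N^T = N ->
  sphere_integral (fun u => (u *m N *m u^T) 0 0 ^+ 2)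
  = 4 * pi / 15 * ((\tr N) ^+ 2 + 2 * \tr (N *m N)).
Proof.
move=> NT.
set a := N 0 0; set b := N 1 1; set c := N 2%:R 2%:R.
set d := N 0 1; set e := N 0 2%:R; set f := N 1 2%:R.
(* The arguments are the coefficients of the expanded square of the quadratic form. *)
rewrite (@sphere_integral_quartic R
  (a ^+ 2) (4 * a * d) (4 * a * e) (2 * a * b + 4 * d ^+ 2)
  (4 * a * f + 8 * d * e) (2 * a * c + 4 * e ^+ 2) (4 * b * d)
  (4 * b * e + 8 * d * f) (4 * c * d + 8 * e * f) (4 * c * e) (b ^+ 2)
  (4 * b * f) (2 * b * c + 4 * f ^+ 2) (4 * c * f) (c ^+ 2)).
  rewrite /mxtrace !sum_ord3 !mxE !sum_ord3.
  move/matrixP : NT => NT.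
  have := NT 0 1; have := NT 0 2%:R; have := NT 1 2%:R; rewrite !mxE => -> -> ->.
  by rewrite /a /b /c /d /e /f; field.
by move=> u; rewrite quad_formE// /a /b /c /d /e /f; ring.
Qed.

Variables (rho : 'M[R[i]]_(2 * 2)) (T : 'M[R]_3).
Hypothesis rhoT : forall u v, correlation rho u v = (u *m T *m v^T) 0 0.

Lemma trmx_gram m n (A : 'M[R]_(m, n)) : (A^T *m A)^T = A^T *m A.
Proof. by rewrite trmx_mul trmxK. Qed.

(** With [w = u *m T], this makes a squared correlation a quadratic form in [v], ready for the
    sphere integrals. *)
Lemma sqr_dotmx (w v : 'rV[R]_3) :
  (w *m v^T) 0 0 ^+ 2 = (v *m (w^T *m w) *m v^T) 0 0.
Proof.
rewrite mulmxA -mulmxA [in RHS]mxE big_ord1 expr2; congr (_ * _).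
by rewrite !mxE; apply: eq_bigr => i _; rewrite !mxE mulrC.
Qed.

Lemma dotmx_tr (w : 'rV[R]_3) : \tr (w^T *m w) = (w *m w^T) 0 0.
Proof. by rewrite mxtrace_mulC /mxtrace big_ord1. Qed.

Lemma moment2_trace : moment rho 2 = \tr (T *m T^T) / 9.
Proof.
rewrite /moment.
rewrite (_ : (fun u1 => _) =
    fun u => (u *m ((4 * pi / 3) *: (T *m T^T)) *m u^T) 0 0); last first.
  apply/funext => u.
  under [X in sphere_integral X]eq_fun do rewrite rhoT sqr_dotmx.
  rewrite sphere_integral_quad_form ?trmx_gram// dotmx_tr trmx_mul.
  by rewrite -scalemxAr -scalemxAl [RHS]mxE !mulmxA.
rewrite sphere_integral_quad_form; last first.
  by rewrite linearZ /= trmx_mul trmxK.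
rewrite linearZ /=.
by have := lt0r_neq0 (pi_gt0 R); move: (pi : R) => p p0; field.
Qed.

Lemma moment4_trace : moment rho 4 =
  ((\tr (T *m T^T)) ^+ 2 + 2 * \tr (T *m T^T *m (T *m T^T))) / 75.
Proof.
set N := T *m T^T.
have NT : N^T = N by rewrite /N trmx_mul trmxK.
rewrite /moment.
(* The inner integral is [4 * pi / 15 * (1 + 2)] times the squared form of [N]; the square root
   moves this factor inside the square, so that the same lemma handles the outer integral. *)
rewrite (_ : (fun u1 => _) = fun u =>
   (u *m (Num.sqrt (4 * pi / 5) *: N) *m u^T) 0 0 ^+ 2); last first.
  apply/funext => u.
  under [X in sphere_integral X]eq_fun do
    rewrite rhoT (exprM _ 2 2) sqr_dotmx.
  rewrite sphere_integral_quad_form_sqr ?trmx_gram//.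
  rewrite -scalemxAr -scalemxAl [in RHS]mxE exprMn sqr_sqrtr; last first.
    by rewrite !mulr_ge0 ?pi_ge0 ?invr_ge0.
  have -> : (u *m N *m u^T) 0 0 = \tr ((u *m T)^T *m (u *m T)).
    by rewrite dotmx_tr trmx_mul !mulmxA.
  set w := u *m T.
  (* The matrix [w^T *m w] has rank at most one. *)
  have -> : \tr (w^T *m w *m (w^T *m w)) = \tr (w^T *m w) ^+ 2.
    rewrite -mulmxA (mulmxA w) [w *m w^T]mx11_scalar mul_scalar_mx -scalemxAr.
    by rewrite linearZ /= dotmx_tr expr2.
  by field.
rewrite sphere_integral_quad_form_sqr; last by rewrite linearZ /= NT.
rewrite -scalemxAl -scalemxAr !linearZ /=.
rewrite [(Num.sqrt _ * _) ^+ 2]exprMn (mulrA (Num.sqrt _)) -expr2.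
rewrite sqr_sqrtr; last by rewrite !mulr_ge0 ?pi_ge0 ?invr_ge0.
by have := lt0r_neq0 (pi_gt0 R); move: (pi : R) => p p0; field.
Qed.

End Moments.

(** * Bloch vectors *)

Section Bloch.
Variable R : realType.

Lemma sum_ord2 (V : nmodType) (F : 'I_2 -> V) : \sum_i F i = F 0 + F 1.
Proof.
rewrite !big_ord_recl big_ord0 addr0; congr (_ + F _); exact/val_inj.
Qed.

Lemma mxtrace_tens (K : comPzRingType) m n (A : 'M[K]_m) (B : 'M[K]_n) :
  \tr (A *t B) = \tr A * \tr B.
Proof.
rewrite /mxtrace mulr_sum; apply: eq_bigr => k _.
by case: (mxtens_indexP k) => i j; rewrite tensmxE !mxtens_indexK.
Qed.

Lemma hermsym_entry n (A : 'M[R[i]]_n) i j :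
  A \is hermsymmx -> A i j = (A j i)^*.
Proof.
by move=> /is_hermitianmxP; rewrite expr0 scale1r => /matrixP /(_ i j); rewrite !mxE.
Qed.

Lemma density_mx2 (A : 'M[R[i]]_2) : is_density A ->
  exists p q r : R, exists s : R,
    [/\ A 0 0 = p%:C, A 1 1 = r%:C, A 0 1 = q +i* s, A 1 0 = q -i* s & p + r = 1
       /\ q ^+ 2 + s ^+ 2 <= p * r].
Proof.
move=> [[Ah Apsd] Atr].
have := hermsym_entry 0 0 Ah; have := hermsym_entry 1 1 Ah.
have := hermsym_entry 1 0 Ah.
case A00 : (A 0 0) => [p p']; case A11 : (A 1 1) => [r r'].
case A01 : (A 0 1) => [q s]; case A10 : (A 1 0) => [q' s'].
move=> [eq eqs] [er] [ep].
have p0 : p' = 0 by lra.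
have r0 : r' = 0 by lra.
subst p' r' q' s'.
have pr1 : p + r = 1.
  move: Atr; rewrite /mxtrace sum_ord2.
  by rewrite A00 A11 => -[].
exists p, q, r, s; split => //; split => //.
have qform (x y : R[i]) : 0 <= x^* * (p%:C * x + (q +i* s) * y)
    + y^* * ((q -i* s) * x + r%:C * y).
  have := Apsd (\col_(i < 2) (if i == 0 then x else y)).
  rewrite !mxE sum_ord2 !mxE !sum_ord2 !mxE /= A00 A01 A10 A11.
  congr (0 <= _).
  rewrite -[p%:C]/(p +i* 0) -[r%:C]/(r +i* 0).
  move: (p +i* 0) (q -i* s) (q +i* s) (r +i* 0) => a b c d.
  by rewrite !mulrDl !mulrDr !mulrA addrACA.
(* These two test vectors give [p] and [r] times the determinant; adding them and using [p + r = 1]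
   avoids a case split on a zero diagonal entry. *)
have := qform (- (q +i* s)) (p%:C); rewrite lecE /= => /andP[_ h1].
have := qform (r%:C) (- (q -i* s)); rewrite lecE /= => /andP[_ h2].
have : 0 <= (p + r) * (p * r - (q ^+ 2 + s ^+ 2)) by lra.
by rewrite pr1 mul1r subr_ge0.
Qed.

Lemma sigmaE (u : 'rV[R]_3) : sigma u =
  mx2 (u 0 2%:R)%:C (u 0 0 -i* u 0 1) (u 0 0 +i* u 0 1) (- u 0 2%:R)%:C.
Proof.
apply/matrixP => i j; rewrite !mxE.
by case: ifP => _; case: ifP => _; apply/eqP; rewrite eq_complex /=;
  apply/andP; split; apply/eqP; ring.
Qed.

Lemma density_bloch (A : 'M[R[i]]_2) : is_density A ->
  exists2 a : 'rV[R]_3, (a *m a^T) 0 0 <= 1 &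
    forall u, \tr (A *m sigma u) = ((a *m u^T) 0 0)%:C.
Proof.
move=> /density_mx2[p [q [r [s [A00 A11 A01 A10 [pr1 qs]]]]]].
(* The entries are the traces of [A] against the three Pauli matrices; the squared norm is
   [(p + r) ^+ 2] minus four times the determinant of [A]. *)
exists (\row_(i < 3) [:: 2 * q; - (2 * s); p - r]`_i).
  rewrite !mxE sum_ord3 !mxE /=.
  by have : (p + r) ^+ 2 = 1 by [rewrite pr1 expr1n]; lra.
move=> u; rewrite /mxtrace sigmaE sum_ord2 !mxE !sum_ord2 sum_ord3 !mxE /=.
rewrite A00 A01 A10 A11; apply/eqP; rewrite eq_complex /=.
by apply/andP; split; apply/eqP; ring.
Qed.

End Bloch.

Lemma separable_correlation (R : realType) (rho : 'M[R[i]]_(2 * 2)) :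
  is_separable rho ->
  exists (n : nat) (p : 'I_n -> R) (a b : 'I_n -> 'rV[R]_3),
  [/\ forall k, 0 <= p k, \sum_k p k = 1,
      forall k, (a k *m (a k)^T) 0 0 <= 1, forall k, (b k *m (b k)^T) 0 0 <= 1
    & forall u v, correlation rho u v =
        (u *m (\sum_k p k *: ((a k)^T *m b k)) *m v^T) 0 0].
Proof.
move=> [n [p [A [B [p0 p1 Ad Bd ->]]]]].
pose a k := sval (cid2 (density_bloch (Ad k))).
pose b k := sval (cid2 (density_bloch (Bd k))).
exists n, p, a, b; split => //.
- by move=> k; rewrite /a; case: cid2.
- by move=> k; rewrite /b; case: cid2.
move=> u v; rewrite /correlation.
(* Proving the complex trace itself to be a real number avoids pushing the real part through the
   sum; each product state then factors into two Bloch pairings. *)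
suff -> : \tr ((\sum_k (p k)%:C *: (A k *t B k)) *m (sigma u *t sigma v)) =
    ((u *m (\sum_k p k *: ((a k)^T *m b k)) *m v^T) 0 0)%:C by [].
rewrite mulmx_suml linear_sum mulmx_sumr mulmx_suml summxE rmorph_sum.
apply: eq_bigr => k _ /=.
rewrite -scalemxAl linearZ /= tensmx_mul mxtrace_tens.
have -> : \tr (A k *m sigma u) = ((a k *m u^T) 0 0)%:C.
  by rewrite /a; case: cid2.
have -> : \tr (B k *m sigma v) = ((b k *m v^T) 0 0)%:C.
  by rewrite /b; case: cid2.
rewrite -!rmorphM -scalemxAr -scalemxAl; congr (_%:C); rewrite [RHS]mxE.
congr (_ * _); rewrite !mulmxA -(mulmxA (_ *m _)) [RHS]mxE big_ord1.
by congr (_ * _); rewrite !mxE; apply: eq_bigr => i _; rewrite !mxE mulrC.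
Qed.

(** * Singular values *)

Section SingularValues.
Variable C : numClosedFieldType.

Lemma normCsq_mx n (v : 'cV[C]_n) : (v^t* *m v) 0 0 = \sum_i `|v i 0| ^+ 2.
Proof. by rewrite mxE; apply: eq_bigr => i _; rewrite !mxE normCKC. Qed.

Lemma normCsq_mx_ge0 n (v : 'cV[C]_n) : 0 <= (v^t* *m v) 0 0.
Proof. by rewrite normCsq_mx sumr_ge0// => i _; rewrite exprn_ge0. Qed.

Lemma trmxC_mul m n p (A : 'M[C]_(m, n)) (B : 'M[C]_(n, p)) :
  (A *m B)^t* = B^t* *m A^t*.
Proof. by rewrite trmx_mul map_mxM. Qed.

(** The hypothesis makes [W^t* *m W] an orthogonal projection, and the gap is the squared norm of
    [c - W^t* *m W *m c]. *)
Lemma Bessel_partial_isometry m n (W : 'M[C]_(m, n)) (c : 'cV[C]_n) :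
  W *m W^t* *m W = W ->
  ((W *m c)^t* *m (W *m c)) 0 0 <= (c^t* *m c) 0 0.
Proof.
move=> WWW; rewrite -subr_ge0; set y := W *m c.
have Wy : W *m (W^t* *m y) = y by rewrite /y !mulmxA WWW.
have Wc : c^t* *m W^t* = y^t* by rewrite -trmxC_mul.
suff -> : (c^t* *m c) 0 0 - (y^t* *m y) 0 0 =
    ((c - W^t* *m y)^t* *m (c - W^t* *m y)) 0 0 by exact: normCsq_mx_ge0.
have -> : (c - W^t* *m y)^t* = c^t* - y^t* *m W.
  by rewrite [in LHS]linearB /= map_mxB trmxC_mul trmxCK.
rewrite mulmxBl !mulmxBr -!mulmxA Wy (mulmxA _ (W^t*)) Wc -/y subrr subr0.
by rewrite !mxE.
Qed.

End SingularValues.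

(** * Trace norm of convex combinations of rank-one matrices *)

Section TraceNorm.
Variable C : numClosedFieldType.

Lemma hermitian_spectral_decomposition n (H : 'M[C]_n) : H \is hermsymmx ->
  exists (P : 'M[C]_n) (D : 'rV[C]_n),
    [/\ P *m P^t* = 1%:M, P^t* *m P = 1%:M & H = P^t* *m diag_mx D *m P].
Proof.
move=> Hh; have Pu := spectral_unitarymx H.
have PP := elimT (@unitarymxP C n n (spectralmx H)) Pu.
exists (spectralmx H), (spectral_diag H); split => //; first exact: mulmx1C.
rewrite -(invmx_unitary Pu).
exact: (elimT (@orthomx_spectralP C n H) (hermitian_normalmx Hh)).
Qed.

(** Each product is bounded by the mean of the two squared moduli; exchanging the sums then leaves a
    convex combination of numbers at most 1. *)
Lemma sum_bilinear_le1 N m (p : 'I_N -> C)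
    (s : 'I_m -> C) (x y : 'I_N -> 'cV[C]_m) :
  (forall k, 0 <= p k) -> \sum_k p k = 1 -> (forall i, 0 <= s i) ->
  (forall i, s i = \sum_k p k * (x k i 0 * (y k i 0)^*%R)) ->
  (forall k, \sum_i `|x k i 0| ^+ 2 <= 1) ->
  (forall k, \sum_i `|y k i 0| ^+ 2 <= 1) ->
  \sum_i s i <= 1.
Proof.
move=> p0 p1 s0 sE x1 y1.
have s_le i : s i <= \sum_k p k * ((`|x k i 0| ^+ 2 + `|y k i 0| ^+ 2) / 2).
  rewrite -[leLHS](ger0_norm (s0 i)) sE.
  apply: le_trans (ler_norm_sum _ _ _) _; apply: ler_sum => k _.
  rewrite normrM (ger0_norm (p0 k)) ler_wpM2l// normrM norm_conjC.
  move: (x k i 0) (y k i 0) => u v.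
  rewrite -subr_ge0 (_ : _ - _ = (`|u| - `|v|) ^+ 2 / 2); last by field.
  by rewrite divr_ge0// real_exprn_even_ge0// rpredB// normr_real.
apply: le_trans (ler_sum _ (fun i _ => s_le i)) _.
rewrite exchange_big /= -[leRHS]p1; apply: ler_sum => k _.
rewrite -mulr_sumr -[leRHS]mulr1 ler_wpM2l// -mulr_suml big_split /=.
by rewrite ler_pdivrMr// mul1r -[2]/(1 + 1) lerD.
Qed.

(* [s] lists the singular values of [T]. If [Y = P *m T] with [P] diagonalizing
   [T *m T^t*], the rows of [Y] are orthogonal with squared norms [s i ^+ 2], so
   [W], obtained by normalizing the nonzero ones, is a partial isometry and
   [s i = \sum_k p k * (P *m a k)_i * ((W *m b k)_i)^*]. *)
Lemma convex_rank1_singular_values m N (p : 'I_N -> C)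
    (a b : 'I_N -> 'cV[C]_m) (T := \sum_k p k *: (a k *m (b k)^t*)) :
  (forall k, 0 <= p k) -> \sum_k p k = 1 ->
  (forall k, ((a k)^t* *m a k) 0 0 <= 1) ->
  (forall k, ((b k)^t* *m b k) 0 0 <= 1) ->
  exists s : 'I_m -> C,
  [/\ forall i, 0 <= s i, \sum_i s i <= 1,
      \tr (T *m T^t*) = \sum_i s i ^+ 2
    & \tr (T *m T^t* *m (T *m T^t*)) = \sum_i s i ^+ 4].
Proof.
move=> p0 p1 a1 b1; set H := T *m T^t*.
have Hherm : H \is hermsymmx.
  by apply/is_hermitianmxP; rewrite expr0 scale1r /H trmxC_mul trmxCK.
have [P [D [PP PP' HD]]] := hermitian_spectral_decomposition Hherm.
pose Y := P *m T.
have YY : Y *m Y^t* = diag_mx D.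
  rewrite /Y trmxC_mul !mulmxA -(mulmxA P) -/H HD !mulmxA PP mul1mx.
  by rewrite -mulmxA PP mulmx1.
have DE i : D 0 i = (Y *m Y^t*) i i by rewrite YY mxE eqxx mulr1n.
have D_ge0 i : 0 <= D 0 i.
  by rewrite DE mxE sumr_ge0// => j _; rewrite !mxE mul_conjC_ge0.
pose s i := sqrtC (D 0 i).
have s_ge0 i : 0 <= s i by rewrite sqrtC_ge0.
have Ds i : D 0 i = s i ^+ 2 by rewrite sqrtCK.
have s_conj i : ((s i)^-1)^*%R = (s i)^-1.
  by apply: CrealP; rewrite realV ger0_real.
exists s; split => //.
- pose x k := P *m a k.
  have YE : Y = \sum_k p k *: (x k *m (b k)^t*).
    rewrite /Y /T mulmx_sumr; apply: eq_bigr => k _.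
    by rewrite -scalemxAr mulmxA.
  pose W := diag_mx (\row_i (s i)^-1) *m Y.
  have WE k i : (W *m b k) i 0 = (s i)^-1 * (Y *m b k) i 0.
    by rewrite -mulmxA mul_diag_mx !mxE.
  have WWW : W *m W^t* *m W = W.
    (* As the inverse of 0 is 0, these diagonal entries are 1 where [s i] is nonzero and 0
       elsewhere. *)
    have -> : W *m W^t* = diag_mx (\row_i ((s i)^-1 * s i)).
      rewrite trmxC_mul mulmxA -(mulmxA _ Y) YY tr_diag_mx map_diag_mx.
      rewrite !mulmx_diag; congr diag_mx; apply/rowP => i; rewrite !mxE Ds.
      rewrite [X in _ * X](s_conj i).
      by have [->|si0] := eqVneq (s i) 0; [rewrite invr0 !mulr0|field].
    rewrite mulmxA mulmx_diag; congr (diag_mx _ *m _).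
    apply/rowP => i; rewrite !mxE.
    by have [->|si0] := eqVneq (s i) 0; [rewrite invr0 mulr0|field].
  apply: (@sum_bilinear_le1 _ _ p s x (fun k => W *m b k)) => //.
  (* Only the left factor of [Y *m Y^t*] is expanded into rank-one terms; the right one, divided by
     [s i], becomes [W]. *)
  + move=> i; transitivity ((s i)^-1 * D 0 i).
      rewrite Ds.
      by have [->|si0] := eqVneq (s i) 0; [rewrite invr0 mul0r|field].
    rewrite DE {1}YE mulmx_suml summxE mulr_sumr; apply: eq_bigr => k _.
    rewrite WE rmorphM /= s_conj -scalemxAl mxE mulrCA; congr (_ * _).
    rewrite -mulmxA -trmxC_mul mxE big_ord1 mulrCA; congr (_ * (_ * _)).
    by rewrite 2!mxE.
  + move=> k; rewrite -normCsq_mx trmxC_mul mulmxA -(mulmxA _ _ P) PP' mulmx1.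
    exact: a1.
  + move=> k; rewrite -normCsq_mx.
    exact: le_trans (Bessel_partial_isometry _ WWW) (b1 k).
- rewrite HD mxtrace_mulC mulmxA PP mul1mx mxtrace_diag.
  by apply: eq_bigr => i _; rewrite Ds.
- rewrite HD -!mulmxA (mulmxA P) PP mul1mx mxtrace_mulC -!mulmxA PP mulmx1.
  rewrite mulmx_diag mxtrace_diag.
  by apply: eq_bigr => i _; rewrite mxE !Ds -exprD.
Qed.

End TraceNorm.

(** The matrices are embedded into [R[i]], where the spectral theorem is available; nonnegative
    complex numbers are real, so real parts lose nothing. *)
Lemma convex_rank1_real_singular_values (R : realType) m N (p : 'I_N -> R)
    (a b : 'I_N -> 'rV[R]_m) (T := \sum_k p k *: ((a k)^T *m b k)) :
  (forall k, 0 <= p k) -> \sum_k p k = 1 ->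
  (forall k, (a k *m (a k)^T) 0 0 <= 1) ->
  (forall k, (b k *m (b k)^T) 0 0 <= 1) ->
  exists s : 'I_m -> R,
  [/\ forall i, 0 <= s i, \sum_i s i <= 1,
      \tr (T *m T^T) = \sum_i s i ^+ 2
    & \tr (T *m T^T *m (T *m T^T)) = \sum_i s i ^+ 4].
Proof.
move=> p0 p1 a1 b1.
pose toC k l (A : 'M[R]_(k, l)) : 'M[R[i]]_(k, l) := map_mx (real_complex R) A.
have toCM k l n (A : 'M[R]_(k, l)) (B : 'M[R]_(l, n)) :
  toC _ _ (A *m B) = toC _ _ A *m toC _ _ B by exact: map_mxM.
have toCT k l (A : 'M[R]_(k, l)) : (toC _ _ A)^t* = toC _ _ A^T.
  by apply/matrixP => i j; rewrite !mxE; exact: conjc_real.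
have toCtr n (A : 'M[R]_n) : \tr (toC _ _ A) = (\tr A)%:C by exact: trace_map_mx.
have TE : toC _ _ T =
    \sum_k (p k)%:C *: (toC _ _ (a k)^T *m (toC _ _ (b k)^T)^t*).
  rewrite /T /toC map_mx_sum; apply: eq_bigr => k _.
  by rewrite map_mxZ map_mxM -!/(toC _ _ _) toCT trmxK.
have [|||k|s [s0 s1 s2 s4]] := @convex_rank1_singular_values R[i] m N
  (fun k => (p k)%:C) (fun k => toC _ _ (a k)^T) (fun k => toC _ _ (b k)^T).
- by move=> k; rewrite ler0c.
- by rewrite -rmorph_sum p1.
- by move=> k; rewrite toCT trmxK -toCM mxE -[1]/(1%:C) lecR.
- by rewrite toCT trmxK -toCM mxE -[1]/(1%:C) lecR.
pose r i := complex.Re (s i).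
have sr i : s i = (r i)%:C.
  by rewrite [RHS]RRe_real// ger0_real.
exists r; split.
- by move=> i; rewrite -ler0c -sr.
- rewrite -lecR (_ : (\sum_i r i)%:C = \sum_i s i)//.
  by rewrite rmorph_sum; apply: eq_bigr => i _; rewrite sr.
- apply: complexI; rewrite -toCtr toCM -toCT TE s2 rmorph_sum.
  by apply: eq_bigr => i _; rewrite sr rmorphXn.
- apply: complexI; rewrite -toCtr !toCM -toCT TE s4 rmorph_sum.
  by apply: eq_bigr => i _; rewrite sr rmorphXn.
Qed.

(** * Optimization over the singular values *)

(* [(1 + t) / 3, (1 + t) / 3, (1 - 2 * t) / 3] is the minimizer for its value of
   [x ^+ 2 + y ^+ 2 + z ^+ 2]. Eliminating [x] and [y] through [x + y <= 1 - z],
   the gap is at least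
   [4 * (z - (1 + t) / 3) ^+ 2 * (z - (1 - 2 * t) / 3)], and the maximum [z] is
   at least [1 / 3]. *)
Lemma sum_exp4_ge_max (R : realFieldType) (x y z t : R) :
  0 <= x -> 0 <= y -> 0 <= z -> x <= z -> y <= z -> x + y + z <= 1 ->
  0 <= t ->
  x ^+ 2 + y ^+ 2 + z ^+ 2 = (1 + 2 * t ^+ 2) / 3 ->
  2 * ((1 + t) / 3) ^+ 4 + ((1 - 2 * t) / 3) ^+ 4 <= x ^+ 4 + y ^+ 4 + z ^+ 4.
Proof.
move=> x0 y0 z0 xz yz s1 t0 q.
(* The sum of squares is at least 1/3, and at most [z * (x + y + z) <= z]. *)
have z13 : 1 / 3 <= z by nra.
(* This is [(1 - z) ^+ 2] minus the value of [x ^+ 2 + y ^+ 2]. *)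
pose K := 1 - 2 * z + 2 * z ^+ 2 - (1 + 2 * t ^+ 2) / 3.
have xyK : 2 * (x * y) <= K.
  rewrite /K -q; have : (x + y) ^+ 2 <= (1 - z) ^+ 2.
    by rewrite lerXn2r ?nnegrE; lra.
  nra.
have xy0 : 0 <= x * y by exact: mulr_ge0.
have xy2 : 4 * (x * y) ^+ 2 <= K ^+ 2.
  have : (2 * (x * y)) ^+ 2 <= K ^+ 2 by rewrite lerXn2r ?nnegrE; lra.
  by rewrite exprMn; lra.
have -> : x ^+ 4 + y ^+ 4 + z ^+ 4
    = z ^+ 4 + ((1 + 2 * t ^+ 2) / 3 - z ^+ 2) ^+ 2 - 2 * (x * y) ^+ 2.
  by rewrite -q; ring.
have : 0 <= 4 * ((z - (1 + t) / 3) ^+ 2 * (z - (1 - 2 * t) / 3)).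
  by rewrite mulr_ge0// mulr_ge0// ?sqr_ge0//; lra.
have -> : 4 * ((z - (1 + t) / 3) ^+ 2 * (z - (1 - 2 * t) / 3))
  = z ^+ 4 + ((1 + 2 * t ^+ 2) / 3 - z ^+ 2) ^+ 2 - K ^+ 2 / 2
    - (2 * ((1 + t) / 3) ^+ 4 + ((1 - 2 * t) / 3) ^+ 4).
  by rewrite /K; field.
lra.
Qed.

(** By symmetry a largest variable can play the role of [z]. *)
Lemma sum_exp4_ge (R : realFieldType) (x y z t : R) :
  0 <= x -> 0 <= y -> 0 <= z -> x + y + z <= 1 -> 0 <= t ->
  x ^+ 2 + y ^+ 2 + z ^+ 2 = (1 + 2 * t ^+ 2) / 3 ->
  2 * ((1 + t) / 3) ^+ 4 + ((1 - 2 * t) / 3) ^+ 4 <= x ^+ 4 + y ^+ 4 + z ^+ 4.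
Proof.
move=> x0 y0 z0 s1 t0 q.
have [xz|zx] := leP x z; have [yz|zy] := leP y z; have [xy|yx] := leP x y.
- exact: sum_exp4_ge_max.
- exact: sum_exp4_ge_max.
- have := @sum_exp4_ge_max _ x z y t; lra.
- have := @sum_exp4_ge_max _ x z y t; lra.
- have := @sum_exp4_ge_max _ y z x t; lra.
- have := @sum_exp4_ge_max _ y z x t; lra.
- have := @sum_exp4_ge_max _ x z y t; lra.
- have := @sum_exp4_ge_max _ y z x t; lra.
Qed.

Lemma f_LB_sep_le (R : realType) (x y z : R) :
  0 <= x -> 0 <= y -> 0 <= z -> x + y + z <= 1 ->
  f_LB_sep ((x ^+ 2 + y ^+ 2 + z ^+ 2) / 9)
  <= ((x ^+ 2 + y ^+ 2 + z ^+ 2) ^+ 2 + 2 * (x ^+ 4 + y ^+ 4 + z ^+ 4)) / 75.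
Proof.
move=> x0 y0 z0 s1.
set q := x ^+ 2 + _ + _; rewrite /f_LB_sep.
case: ifPn => [_|]; last (rewrite -ltNge => q1; case: ifPn => [_|_]).
(* First branch: Cauchy-Schwarz bounds [q ^+ 2] by three times the sum of fourth powers. *)
- have : 0 <= (x ^+ 2 - y ^+ 2) ^+ 2 + (x ^+ 2 - z ^+ 2) ^+ 2
            + (y ^+ 2 - z ^+ 2) ^+ 2.
    by rewrite !addr_ge0 ?sqr_ge0.
  by rewrite /q; lra.
- have w0 : 0 <= 27 * (q / 9) - 1 by lra.
  (* The nonnegative solution of [q = (1 + 2 * t ^+ 2) / 3]; the power 3/2 in the bound then becomes
     a multiple of [t ^+ 3]. *)
  pose t := Num.sqrt 2 * Num.sqrt (27 * (q / 9) - 1) / 2.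
  have t0 : 0 <= t by rewrite /t !mulr_ge0 ?sqrtr_ge0.
  have qt : q = (1 + 2 * t ^+ 2) / 3.
    by rewrite /t !exprMn !sqr_sqrtr //; field.
  have := @sum_exp4_ge _ x y z t x0 y0 z0 s1 t0 qt.
  have -> : (3 / 2 : R) = 2^-1 * 3%:R by rewrite mulrC.
  rewrite powRrM powR12_sqrt// powR_mulrn ?sqrtr_ge0//.
  have -> : 4 * Num.sqrt 2 / 3 ^+ 4 * Num.sqrt (27 * (q / 9) - 1) ^+ 3
      = 16 / 81 * t ^+ 3 :> R.
    rewrite /t expr_div_n exprMn (exprS (Num.sqrt 2) 2) sqr_sqrtr//.
    by field.
  rewrite qt; lra.
(* Third branch: the sum of fourth powers is written in [q], [e] and a nonnegative remainder that
   vanishes when one variable is 0; dropping it and using [2 * e <= 1 - q] gives the bound. *)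
- have s2 : (x + y + z) ^+ 2 <= 1 by rewrite expr_le1// !addr_ge0.
  set e := x * y + x * z + y * z.
  have e0 : 0 <= e by rewrite !addr_ge0 ?mulr_ge0.
  have e1 : 2 * e <= 1 - q by rewrite /e /q; lra.
  have e2 : 4 * e ^+ 2 <= (1 - q) ^+ 2 by nra.
  have -> : x ^+ 4 + y ^+ 4 + z ^+ 4
    = q ^+ 2 - 2 * e ^+ 2 + 4 * (x * y * z * (x + y + z)).
    by rewrite /q /e; ring.
  have e3 : 0 <= x * y * z * (x + y + z) by rewrite !mulr_ge0 ?addr_ge0.
  lra.
Qed.

Theorem mainTheorem1 (R : realType) (rho : 'M[R[i]]_(2 * 2))
    (rho_state : is_density rho) (rho_sep : is_separable rho) :
  0 <= F_sep (moment rho 2) (moment rho 4).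
Proof.
have [n [p [a [b [p0 p1 a1 b1 E]]]]] := separable_correlation rho_sep.
rewrite /F_sep (moment2_trace E) (moment4_trace E) subr_ge0.
have [s [s0 s1 -> ->]] := convex_rank1_real_singular_values p0 p1 a1 b1.
by rewrite !sum_ord3 in s1 *; exact: f_LB_sep_le.
Qed.
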